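(* For a map $f:\mathbb{N}\to\mathbb{N}$ the following are equivalent: (1) $f$ is congruence preserving on the algebra $\langle\mathbb{N};+\rangle$; (2) (i) $x-y$ divides $f(x)-f(y)$ for all $x,y\in\mathbb{N}$, and (ii) either $f$ is constant or $f(x)\geq x$ for all $x\in\mathbb{N}$.
   Context: A congruence on $\langle\mathbb{N};+\rangle$ is an equivalence relation $\sim$ on $\mathbb{N}$ such that $x\sim y$ and $x'\sim y'$ imply $x+x'\sim y+y'$. A function $f:\mathbb{N}\to\mathbb{N}$ is congruence preserving if for every such congruence $\sim$, $x\sim y$ implies $f(x)\sim f(y)$. *)

(* Defs.v *)
From Stdlib Require Import RelationClasses.
From mathcomp Require Import all_boot all_order all_algebra.

Set Implicit Arguments.
Unset Strict Implicit.
Unset Printing Implicit Defensive.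

(* Relations are Prop-valued so that undecidable ones are not excluded. *)
Definition add_congruence (r : nat -> nat -> Prop) : Prop :=
  Equivalence r /\
  forall x y x' y' : nat, r x y -> r x' y' -> r (x + x') (y + y').

Definition congruence_preserving (f : nat -> nat) : Prop :=
  forall r : nat -> nat -> Prop, add_congruence r ->
  forall x y : nat, r x y -> r (f x) (f y).

(* Main.v *)
Require Import Defs.
From Stdlib Require Import Classical.
From mathcomp Require Import all_boot all_order all_algebra.

(** (i) is preservation of the congruences modulo [d]. If [f a < a], the
    congruence collapsing [a, a+1, ...] to one class forces [f] to be constant
    from [a] on, and divisibility by arbitrarily large differences then forces
    [f] to be constant. Conversely, [x ~ x + d] gives [x + t ~ x + t + k d] for
    all [t] and [k], so any two numbers above [x] that agree modulo [d] are
    related. *)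

(** As [x <= y], the truncated [y - x] is a true difference; divisibility ignores the sign of the
    divisor. *)
Lemma dvdz_sub_eqn_mod (x y a b : nat) : x <= y ->
  ((x%:Z - y%:Z)%R %| (a%:Z - b%:Z)%R)%Z = (a == b %[mod y - x]).
Proof.
move=> le_xy.
by rewrite dvdzE distnC (subzn le_xy) -dvdzE -eqz_mod_dvd !modz_nat.
Qed.

Lemma add_congruence_modn (d : nat) :
  add_congruence (fun u v => u = v %[mod d]).
Proof.
split; first by split=> // u v w -> ->.
by move=> x y x' y' exy exy'; rewrite -modnDm exy exy' modnDm.
Qed.

Lemma add_congruence_tail (a : nat) :
  add_congruence (fun u v => u = v \/ (a <= u /\ a <= v)).
Proof.
split.
  split; [by left | by move=> u v [-> | [? ?]]; [left | right] |].
  move=> u v w [-> // | [au av]] [<- | [_ aw]]; by right.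
move=> x y x' y' [-> | [ax ay]] [-> | [ax' ay']]; first by left.
- by right; rewrite !(leq_trans _ (leq_addl _ _)).
- by right; rewrite !(leq_trans _ (leq_addr _ _)).
- by right; rewrite !(leq_trans _ (leq_addr _ _)).
Qed.

Lemma eqn_mod_unbounded (m n a : nat) :
  (forall d, a <= d -> m = n %[mod d]) -> m = n.
Proof.
(* A modulus at least [a] and above both numbers, so each is its own residue. *)
have [lt_m lt_n] : m < a + (m + n).+1 /\ n < a + (m + n).+1.
  by rewrite !(leq_trans _ (leq_addl _ _)) // ltnS ?leq_addl ?leq_addr.
by move/(_ _ (leq_addr (m + n).+1 a)); rewrite !modn_small.
Qed.

Lemma add_congruence_eqn_mod (r : nat -> nat -> Prop) (x d u v : nat) :
  add_congruence r -> r x (x + d) -> x <= u -> x <= v ->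
  u = v %[mod d] -> r u v.
Proof.
move=> [[rR rS rT] rD] rx.
have shift k w : x <= w -> r w (w + k * d).
  move=> le_xw; elim: k => [|k IHk]; first by rewrite addn0; apply: rR.
  apply: rT IHk _; rewrite mulSn addnCA.
  (* Both sides become translates of [x] and [x + d] by the same [w - x + k * d], which is where
     [x <= w] enters. *)
  rewrite -(subnKC le_xw) -addnA [d + _]addnA [d + x]addnC.
  exact: rD rx (rR _).
wlog le_uv: u v / u <= v => [hw|].
  have [le_uv|/ltnW le_vu] := leqP u v; first exact: hw.
  by move=> xu xv /esym uv; apply: rS; apply: hw.
move=> le_xu _ /esym/eqP; rewrite eqn_mod_dvd // => /dvdnP[k def_k].
by rewrite -(subnKC le_uv) def_k; apply: shift.
Qed.

Theorem theorem3p12 (f : nat -> nat) :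
  congruence_preserving f <->
  (forall x y : nat, ((x%:Z - y%:Z)%R %| ((f x)%:Z - (f y)%:Z)%R)%Z) /\
  ((exists c : nat, forall x : nat, f x = c) \/ (forall x : nat, x <= f x)).
Proof.
split=> [fP | [f_dvd f_cases] r r_cong x y].
  have f_mod x y : x <= y -> f x = f y %[mod y - x].
    move=> le_xy; apply: (fP _ (add_congruence_modn _)).
    by apply/esym/eqP; rewrite eqn_mod_dvd.
  split=> [x y|].
    have [le_xy|/ltnW le_yx] := leqP x y.
      by rewrite dvdz_sub_eqn_mod //; apply/eqP/f_mod.
    rewrite dvdzE distnC [X in _ %| X]distnC -dvdzE dvdz_sub_eqn_mod //.
    exact/eqP/f_mod.
  have [le_f|/not_all_ex_not[a /negP]] := classic (forall x, x <= f x).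
    by right.
  rewrite -ltnNge => lt_fa; left; exists (f a) => x.
  have f_tail y : a <= y -> f y = f a.
    move=> le_ay.
    (* The alternative to equality would put [f a] in the tail, against [f a < a]. *)
    case: (fP _ (add_congruence_tail a) y a); [by right | by [] |].
    by case=> _; rewrite leqNgt lt_fa.
  (* For [d >= a] the point [x + d] lies in the tail, so [f x] agrees with [f (x + d) = f a] modulo
     [d]. *)
  apply: (@eqn_mod_unbounded _ _ a) => d le_ad.
  rewrite -(f_tail (x + d)) ?(leq_trans le_ad (leq_addl _ _)) //.
  by have := f_mod x (x + d) (leq_addr d x); rewrite addKn.
case: f_cases => [[c fc] _|le_f]; first by rewrite !fc; case: r_cong => -[].
wlog le_xy: x y / x <= y => [hw rxy|].
  have [le_xy|/ltnW le_yx] := leqP x y; first exact: hw.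
  by case: (r_cong) => -[_ rS _] _; exact: rS _ _ (hw _ _ le_yx (rS _ _ rxy)).
(* Both values lie above [x]: [x <= f x] and [x <= y <= f y]. *)
move=> rxy; apply: (@add_congruence_eqn_mod r x (y - x)) => //.
- by rewrite subnKC.
- exact: leq_trans le_xy (le_f y).
- by apply/eqP; rewrite -dvdz_sub_eqn_mod.
Qed.
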